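(* Let $\mathcal{V}$ be a vector space over a field $\mathbb{F}$ and let $P:\mathcal{V}\to\mathcal{V}$ be a linear operator with a factorisation $P=P_0P_1\cdots P_\ell$ that is a decomposition of $P$, with associated operators $Q_0,\ldots,Q_\ell$. Then $$\mathcal{R}(P)=\bigcap_{i=0}^{\ell}\mathcal{R}(P_i),\qquad\mathcal{N}(P)=\bigoplus_{i=0}^{\ell}\mathcal{N}(P_i).$$ The decomposition of $\mathcal{N}(P)$ is given by the identity $$\mathrm{id}_{\mathcal{N}(P)}=\sum_{i=0}^{\ell}\operatorname{Proj}_i,$$ where, for each $i\in\{0,\ldots,\ell\}$, $\operatorname{Proj}_i:\mathcal{N}(P)\to\mathcal{N}(P_i)$ is the projection given by the restriction of $Q_iP^i$.
   Context: $\mathcal{R}(A)$ and $\mathcal{N}(A)$ denote the image and kernel of a linear operator $A$. Definition (decomposition): for a linear operator $P:\mathcal{V}\to\mathcal{V}$, an expression $P=P_0P_1\cdots P_\ell$ as a composition of linear operators $P_i:\mathcal{V}\to\mathcal{V}$ is a decomposition of $P$ if $\ell\ge1$ and there exist linear operators $Q_i:\mathcal{V}\to\mathcal{V}$, $i=0,\ldots,\ell$, with $$\mathrm{id}_{\mathcal{V}}=Q_0P^0+\cdots+Q_\ell P^\ell,\qquad P^i:=\prod_{j\ne i,\,0\le j\le\ell}P_j,$$ and $P_iP_j=P_jP_i$, $P_iQ_j=Q_jP_i$ for all $i,j\in\{0,\ldots,\ell\}$. *)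

(* Defs.v *)
From HB Require Import structures.
From mathcomp Require Import all_boot all_order all_algebra.
From mathcomp Require Import boolp classical_sets functions.

Set Implicit Arguments.
Unset Strict Implicit.
Unset Printing Implicit Defensive.

Import GRing.Theory.

Local Open Scope classical_set_scope.
Local Open Scope ring_scope.

(* No finite-dimensionality is assumed: operators are bare linear maps of an
   lmodType over a field, and subspaces are classical sets. *)

Section LinearOperators.
Context {F : fieldType} {V : lmodType F}.

Definition lcomp (f g : {linear V -> V}) : {linear V -> V} := f \o g.

Definition lid : {linear V -> V} := idfun.

Definition limage (f : {linear V -> V}) : set V := range f.

Definition lkernel (f : {linear V -> V}) : set V := [set v | f v = 0].

(* The composition is taken in increasing order of the indices. *)
Definition cofactor_op (l : nat) (Ps : 'I_l.+1 -> {linear V -> V})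
    (i : 'I_l.+1) : {linear V -> V} :=
  \big[lcomp/lid]_(j < l.+1 | j != i) Ps j.

Record decomposition_with (P : {linear V -> V}) (l : nat)
    (Ps Qs : 'I_l.+1 -> {linear V -> V}) : Prop := DecompositionWith {
  decomp_length : (1 <= l)%N;
  decomp_factor : P =1 \big[lcomp/lid]_(i < l.+1) Ps i;
  decomp_id : forall v : V, v = \sum_(i < l.+1) Qs i (cofactor_op Ps i v);
  decomp_commPP : forall i j, Ps i \o Ps j =1 Ps j \o Ps i;
  decomp_commPQ : forall i j, Ps i \o Qs j =1 Qs j \o Ps i
}.

Definition subspace_sum (I : finType) (D : pred I) (U : I -> set V) : set V :=
  [set v | exists2 w : I -> V,
     (forall i, D i -> U i (w i)) & v = \sum_(i | D i) w i].

(* W is the internal direct sum of the subspaces U i: every element of W has a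
   unique expression as a sum of elements of the U i, and all sums lie in W. *)
Definition is_direct_sum (I : finType) (W : set V) (U : I -> set V) : Prop :=
  W = subspace_sum predT U /\
  (forall w w' : I -> V,
     (forall i, U i (w i)) -> (forall i, U i (w' i)) ->
     \sum_i w i = \sum_i w' i -> w =1 w').

(* The restriction of f to W is the projection of W onto X along Y; only the
   values of f on W matter when X and Y are contained in W. *)
Definition restricts_to_projection (W X Y : set V) (f : {linear V -> V}) :
    Prop :=
  [/\ set_fun W X f,
      (forall x, X x -> f x = x) &
      (forall y, Y y -> f y = 0)].

End LinearOperators.

(* Main.v *)
Require Import Defs.
From mathcomp Require Import all_boot all_order all_algebra.
From mathcomp Require Import boolp classical_sets functions.

(** Everything follows from the partition of unity id = \sum_i Q_i P^i.  As the
    P_j commute, P = P_i P^i, and P_j is a factor of P^i for j != i; as each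
    Q_i commutes with the P_j, it also commutes with P.

    Images: if v = P_i u_i for every i, then
    v = \sum_i Q_i P^i P_i u_i = \sum_i Q_i P u_i = P (\sum_i Q_i u_i)
    ([limage_decomposition]).

    Kernels: on N(P), the operator Q_i P^i takes its values in N(P_i), because
    P_i Q_i P^i = Q_i P ([projection_in_kernel]); it annihilates N(P_j) for
    j != i ([projection_kernel_neq]), so the partition of unity makes it the
    identity on N(P_i) ([projection_kernel_id]).  The operators Q_i P^i
    therefore split each vector of N(P) along the N(P_i), and applying Q_i P^i
    to a sum of vectors w_j of the N(P_j) recovers w_i, which is the uniqueness
    of the splitting. *)

Set Implicit Arguments.
Unset Strict Implicit.

Import GRing.Theory.

Local Open Scope classical_set_scope.
Local Open Scope ring_scope.

Section CommutingProducts.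
Variables (F : fieldType) (V : lmodType F) (I : eqType).
Variable Ps : I -> {linear V -> V}.

Lemma lcompE (f g : {linear V -> V}) v : lcomp f g v = f (g v).
Proof. by []. Qed.

Lemma big_lcomp_comm (T : {linear V -> V}) (r : seq I) (D : pred I) :
  (forall i, T \o Ps i =1 Ps i \o T) ->
  forall v, T ((\big[lcomp/lid]_(i <- r | D i) Ps i) v)
          = (\big[lcomp/lid]_(i <- r | D i) Ps i) (T v).
Proof.
move=> TP; elim: r => [|j r IHr] v; first by rewrite !big_nil.
rewrite !big_cons; case: ifP => _; last exact: IHr.
by rewrite !lcompE -IHr; apply: TP.
Qed.

Hypothesis commPP : forall i j, Ps i \o Ps j =1 Ps j \o Ps i.

(** Composition of operators is not a commutative law, so this is not an
    instance of [bigD1]: P_i is moved to the front of the product past each of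
    the factors on its left. *)
Lemma big_lcompD1 (i : I) (r : seq I) (D : pred I) : uniq r -> i \in r -> D i ->
  forall v, (\big[lcomp/lid]_(j <- r | D j) Ps j) v
          = Ps i ((\big[lcomp/lid]_(j <- r | D j && (j != i)) Ps j) v).
Proof.
move=> + + Di; elim: r => [//|j r IHr] /= /andP[jr ur].
rewrite inE; case: eqVneq jr => [<- ir _|neq_ij _ /= ir] v.
  rewrite !big_cons Di eqxx lcompE /=.
  (* Since i does not recur in the tail, the condition k != i is void there. *)
  suff -> : \big[lcomp/lid]_(k <- r | D k) Ps k
          = \big[lcomp/lid]_(k <- r | D k && (k != i)) Ps k by [].
  rewrite big_seq_cond [RHS]big_seq_cond; apply: eq_bigl => k.
  by case: eqVneq => [->|]; rewrite ?(negPf ir) ?andbT.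
rewrite !big_cons eq_sym neq_ij andbT; case: ifP => _; last exact: IHr.
by rewrite !lcompE IHr //; apply: commPP.
Qed.

Lemma big_lcomp_eq0 (i : I) (r : seq I) (D : pred I) v :
  uniq r -> i \in r -> D i -> Ps i v = 0 ->
  (\big[lcomp/lid]_(j <- r | D j) Ps j) v = 0.
Proof.
move=> ur ir Di Piv; rewrite (big_lcompD1 ur ir Di).
by rewrite big_lcomp_comm // Piv linear0.
Qed.

End CommutingProducts.

Section Decompositions.
Variables (F : fieldType) (V : lmodType F) (P : {linear V -> V}) (l : nat).
Variables (Ps Qs : 'I_l.+1 -> {linear V -> V}).
Hypothesis hP : decomposition_with P Ps Qs.

Let commPP := decomp_commPP hP.

Lemma decomp_factorD1 i v : P v = Ps i (cofactor_op Ps i v).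
Proof.
rewrite (decomp_factor hP).
by rewrite (big_lcompD1 commPP (index_enum_uniq _) (mem_index_enum i)).
Qed.

Lemma decomp_factorD1r i v : P v = cofactor_op Ps i (Ps i v).
Proof. by rewrite (decomp_factorD1 i) /cofactor_op big_lcomp_comm. Qed.

Lemma decomp_commQ i v : P (Qs i v) = Qs i (P v).
Proof.
rewrite !(decomp_factor hP) [RHS]big_lcomp_comm // => j u.
by rewrite (decomp_commPQ hP j i).
Qed.

Lemma limage_decomposition :
  limage P = \bigcap_(i in [set: 'I_l.+1]) limage (Ps i).
Proof.
apply/seteqP; split=> [_ [v _ <-] i _|v imv].
  by exists (cofactor_op Ps i v) => //; rewrite -decomp_factorD1.
have /choice[u uP] : forall i, exists u, Ps i u = v.
  by move=> i; have [u _ <-] := imv i I; exists u.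
exists (\sum_i Qs i (u i)) => //.
rewrite linear_sum [RHS](decomp_id hP); apply: eq_bigr => i _.
by rewrite decomp_commQ (decomp_factorD1r i) uP.
Qed.

Lemma lkernel_factor_sub i : lkernel (Ps i) `<=` lkernel P.
Proof. by move=> v Piv; rewrite /lkernel /= (decomp_factorD1r i) Piv linear0. Qed.

Lemma projection_in_kernel i v :
  lkernel P v -> lkernel (Ps i) (lcomp (Qs i) (cofactor_op Ps i) v).
Proof.
move=> Pv; have /= := decomp_commPQ hP i i (cofactor_op Ps i v).
by rewrite /lkernel /= => ->; rewrite -decomp_factorD1 Pv linear0.
Qed.

(** For j != i the cofactor P^i still contains the factor P_j. *)
Lemma projection_kernel_neq i j v : j != i ->
  lkernel (Ps j) v -> lcomp (Qs i) (cofactor_op Ps i) v = 0.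
Proof.
move=> neq_ji Pjv; rewrite lcompE /cofactor_op.
rewrite (big_lcomp_eq0 commPP (index_enum_uniq _) (mem_index_enum j)) //.
exact: linear0.
Qed.

(** All other terms of the partition of unity vanish on N(P_i). *)
Lemma projection_kernel_id i v :
  lkernel (Ps i) v -> lcomp (Qs i) (cofactor_op Ps i) v = v.
Proof.
move=> Piv; rewrite [RHS](decomp_id hP) (bigD1 i) //= big1 ?addr0 // => j neq_ji.
by rewrite -[LHS]/(lcomp _ _ _) (@projection_kernel_neq j i) // eq_sym.
Qed.

Lemma projection_sum i (w : 'I_l.+1 -> V) : (forall j, lkernel (Ps j) (w j)) ->
  lcomp (Qs i) (cofactor_op Ps i) (\sum_j w j) = w i.
Proof.
move=> Pw; rewrite linear_sum (bigD1 i) //= big1 ?addr0.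
  exact: projection_kernel_id.
by move=> j neq_ji; apply: (projection_kernel_neq neq_ji (Pw j)).
Qed.

Lemma lkernel_direct_sum : is_direct_sum (lkernel P) (fun i => lkernel (Ps i)).
Proof.
split=> [|w w' Pw Pw' eqww' i]; last first.
  by rewrite -(projection_sum i Pw) eqww' projection_sum.
apply/seteqP; split=> [v Pv|_ [w Pw ->]].
  exists (fun i => lcomp (Qs i) (cofactor_op Ps i) v) => [i _|].
    exact: projection_in_kernel.
  exact: (decomp_id hP).
rewrite /lkernel /= linear_sum big1 // => i _.
exact: lkernel_factor_sub (Pw i isT).
Qed.

Lemma restricts_to_projection_kernel i :
  restricts_to_projection (lkernel P) (lkernel (Ps i))
    (subspace_sum (fun j => j != i) (fun j => lkernel (Ps j)))
    (lcomp (Qs i) (cofactor_op Ps i)).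
Proof.
split=> [v|v|_ [w Pw ->]].
- exact: projection_in_kernel.
- exact: projection_kernel_id.
- rewrite linear_sum big1 // => j neq_ji.
  exact: (projection_kernel_neq neq_ji (Pw j neq_ji)).
Qed.

End Decompositions.

Unset Implicit Arguments.
Set Strict Implicit.

Theorem corollary2p3 (F : fieldType) (V : lmodType F) (P : {linear V -> V})
    (l : nat) (Ps Qs : 'I_l.+1 -> {linear V -> V})
    (hP : decomposition_with P Ps Qs) :
  let Proj (i : 'I_l.+1) : {linear V -> V} :=
    lcomp (Qs i) (cofactor_op Ps i) in
  [/\ limage P = \bigcap_(i in [set: 'I_l.+1]) limage (Ps i),
      is_direct_sum (lkernel P) (fun i => lkernel (Ps i)),
      (forall i, restricts_to_projection (lkernel P) (lkernel (Ps i))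
         (subspace_sum (fun j => j != i) (fun j => lkernel (Ps j))) (Proj i)) &
      (forall v, lkernel P v -> v = \sum_(i < l.+1) Proj i v)].
Proof.
split.
- exact: (limage_decomposition hP).
- exact: (lkernel_direct_sum hP).
- exact: (restricts_to_projection_kernel hP).
- by move=> v _; apply: (decomp_id hP).
Qed.
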